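(* Neither of the sets $$\left\{\frac{m^2+n^2}{2mn}:m,n\in\mathbb{N}\right\}\quad\text{and}\quad\left\{\frac{2mn}{m^2-n^2}:m,n\in\mathbb{N},\ m>n\right\}$$ contains an infinite subsemigroup of $(\mathbb{Q}^{>0},\times)$.
   Context: $\mathbb{N}=\{1,2,\dots\}$; $\mathbb{Q}^{>0}$ is the set of positive rational numbers. *)

(* Defs.v *)
From mathcomp Require Import all_boot all_order all_algebra.
From mathcomp Require Import boolp classical_sets functions cardinality.

Set Implicit Arguments.
Unset Strict Implicit.
Unset Printing Implicit Defensive.

Import Order.TTheory GRing.Theory Num.Theory.
Local Open Scope classical_set_scope.
Local Open Scope ring_scope.

Definition posrat : set rat := [set q | 0 < q].

(* Nonemptiness is left out: below, only infinite subsemigroups matter. *)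
Definition subsemigroup_posrat (S : set rat) : Prop :=
  S `<=` posrat /\ (forall x y, S x -> S y -> S (x * y)).

Definition secant_set : set rat :=
  [set q | exists m n : nat, [/\ (0 < m)%N, (0 < n)%N &
     q = (m%:R ^+ 2 + n%:R ^+ 2) / (2 * m%:R * n%:R)]].

Definition tangent_set : set rat :=
  [set q | exists m n : nat, [/\ (0 < m)%N, (0 < n)%N, (n < m)%N &
     q = (2 * m%:R * n%:R) / (m%:R ^+ 2 - n%:R ^+ 2)]].

(* Main.v *)
Require Import Defs.
From mathcomp Require Import all_boot all_order all_algebra.
From mathcomp Require Import boolp classical_sets functions cardinality.
From mathcomp Require Import zify ring.

(** A secant value [q = (m^2 + n^2) / (2mn)] satisfies [q^2 - 1 = r^2] with [r]
    rational, and a tangent value [q = 2mn / (m^2 - n^2)] satisfies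
    [q^2 + 1 = r^2].  A semigroup inside one of the sets contains [q^2] along
    with [q], so squaring once already leads to one of Fermat's quartic
    equations.

    Tangents: if [q^2] is a tangent value and [q = x/y] in lowest terms, then
    [q^4 + 1] is a square, so [x^4 + y^4] is a square, which is impossible by
    [no_fourth_powers_sum].  Hence a subsemigroup of tangents is even empty.

    Secants: if [q] and [q^2] are secant values, then [q^2 - 1] and [q^4 - 1]
    are squares, and if [q <> 1] so is their quotient [q^2 + 1].  With
    [q = x/y] in lowest terms both [x^2 + y^2] and [x^2 - y^2] are squares of
    integers, which is impossible by [no_sum_and_difference_squares].  Hence a
    subsemigroup of secants has no element besides [1].

    Both impossibility results are infinite descents that apply the
    parametrization of primitive Pythagorean triples by legs [a^2 - b^2], [2ab]
    and hypotenuse [a^2 + b^2] ([primitive_triple]), and then repeatedly use that two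
    coprime numbers whose product is a square are themselves squares
    ([coprime_mul_square]), until a smaller solution appears. *)

Set Implicit Arguments.
Unset Strict Implicit.

Import Order.TTheory GRing.Theory Num.Theory.
Local Open Scope classical_set_scope.
Local Open Scope ring_scope.

(** * Pythagorean triples and infinite descent *)

Section Descent.
Local Open Scope nat_scope.

(** The root of [a] is [gcd(a, c)]: indeed
    [gcd(a, c)^2 = gcd(a^2, c^2) = gcd(a a, a b) = a gcd(a, b) = a]. *)
Lemma coprime_mul_square a b c : coprime a b -> a * b = c ^ 2 ->
  (exists d, a = d ^ 2) /\ (exists e, b = e ^ 2).
Proof.
have sq x y z : coprime x y -> x * y = z ^ 2 -> exists d, x = d ^ 2.
  move=> cxy xyz; case: (posnP x) => [->|x_gt0]; first by exists 0.
  have [[x' xE] [z' zE]] :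
      (exists x', x = x' * gcdn x z) /\ (exists z', z = z' * gcdn x z).
    by split; apply/dvdnP; [exact: dvdn_gcdl | exact: dvdn_gcdr].
  have [g g0] : exists g, g = gcdn x z by eexists.
  rewrite -g0 in xE zE.
  have g_gt0 : 0 < g by rewrite g0 gcdn_gt0 x_gt0.
  have cxz : coprime x' z'.
    by rewrite /coprime -(eqn_pmul2r g_gt0) muln_gcdl -xE -zE -g0 mul1n.
  exists g; have : x * gcdn x y = g ^ 2.
    rewrite muln_gcdr xyz -[x * x]/(x ^ 2) xE zE !expnMn -muln_gcdl.
    by move: (coprimeXl 2 (coprimeXr 2 cxz)) => /eqP ->; rewrite mul1n.
  by rewrite (eqP cxy) muln1.
move=> cab abc; split; first exact: (sq a b c).
by apply: (sq b a c); rewrite 1?coprime_sym 1?mulnC.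
Qed.

Lemma even_exists_half n : ~~ odd n -> exists h, n = 2 * h.
Proof. by move=> en; exists n./2; rewrite mul2n even_halfK. Qed.

Lemma same_parity_sub m n : m <= n -> odd m = odd n -> exists k, n = m + 2 * k.
Proof.
move=> mn par; have [|k nmE] := @even_exists_half (n - m); first by rewrite oddB// par addbb.
by exists k; rewrite -nmE subnKC.
Qed.

Lemma odd_of_coprime_even p q : coprime p q -> ~~ odd q -> odd p.
Proof.
move=> cpq eq; apply: contraTT cpq => ep; rewrite -!dvdn2 in eq ep.
by apply/negP => /eqP g; have := dvdn_gcd 2 p q; rewrite g ep eq.
Qed.

(** Odd squares are [1] modulo [4], and [2] is not a square modulo [4]. *)
Lemma even_leg p q r : p ^ 2 + q ^ 2 = r ^ 2 -> ~~ odd p \/ ~~ odd q.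
Proof.
move=> E; case: (boolP (odd p)) => [op|]; last by left.
case: (boolP (odd q)) => [oq|]; last by right.
have or : ~~ odd r by move: (congr1 odd E); rewrite oddD !oddX op oq /= => <-.
have := odd_double_half p; have := odd_double_half q; have := odd_double_half r.
rewrite op oq (negbTE or) /=; nia.
Qed.

Lemma coprime_sqr_add a b : coprime (a ^ 2 + b ^ 2) b = coprime a b.
Proof.
rewrite addnC -[b ^ 2]/(b * b) /coprime gcdnC gcdnMDl gcdnC.
by rewrite -/(coprime _ _) coprime_pexpl.
Qed.

(** Writing [q = 2h] and [r = p + 2k] turns the Pythagorean equation into
    [k (p + k) = h^2] with coprime factors, so [k = b^2] and
    [p + k = a^2].  The equation for [p] is stated additively because
    subtraction on naturals truncates. *)
Lemma primitive_triple p q r : coprime p q -> ~~ odd q -> 0 < q ->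
  p ^ 2 + q ^ 2 = r ^ 2 ->
  exists a b, [/\ coprime a b, 0 < b, p + b ^ 2 = a ^ 2, q = 2 * a * b
    & r = a ^ 2 + b ^ 2].
Proof.
move=> cpq eq q0 E.
have op := odd_of_coprime_even cpq eq.
have or : odd r by move: (congr1 odd E); rewrite oddD !oddX op (negbTE eq).
have [h qE] := even_exists_half eq.
have pr : p < r by rewrite -ltn_sqr -E -addn1 leq_add2l expn_gt0 q0.
have [k rE] := same_parity_sub (ltnW pr) (etrans op (esym or)).
have hE : k * (p + k) = h ^ 2 by move: E; rewrite qE rE; clear; lia.
(* A common factor of [p] and [k] would divide [h^2], hence [q]. *)
have cpk : coprime p k.
  have : coprime p (h ^ 2).
    by rewrite coprimeXr//; move: cpq; rewrite qE coprimeMr => /andP[].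
  by rewrite -hE coprimeMr => /andP[].
have cs : coprime k (p + k) by rewrite /coprime gcdnDr gcdnC.
have [[b kE] [a aE]] := coprime_mul_square cs hE.
have hab : h = a * b.
  by apply/eqP; rewrite -(eqn_exp2r _ _ (isT : 0 < 2)) -hE aE kE expnMn mulnC.
exists a, b; split.
- by move: cs; rewrite aE kE coprime_pexpl// coprime_pexpr// coprime_sym.
- by move: q0; rewrite qE hab !muln_gt0 => /and3P[].
- by rewrite -kE.
- by rewrite qE hab mulnA.
- by rewrite rE -aE -kE; lia.
Qed.

(** Gives the decrease in both descents: the new solution is measured by the
    root [s] of a number [s^2] that is a parameter of a triple, the old one by
    the hypotenuse [(s^2)^2 + b^2] of that triple. *)
Lemma ltn_quartic_add s b : 0 < b -> s < (s ^ 2) ^ 2 + b ^ 2.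
Proof.
move=> b0; have h n : n <= n ^ 2 by case: n => // n; rewrite -{1}[n.+1]expn1 leq_pexp2l.
by rewrite -addn1 leq_add ?expn_gt0 ?b0// (leq_trans (h s)).
Qed.

(** Descent on [z].  With [y] even, the triple [(x^2, y^2, z)] has parameters
    [a], [b], and [x^2 + b^2 = a^2] is again a primitive triple, with
    parameters [c], [d].  Then [y^2 = 4 c d (c^2 + d^2)] forces [c = e^2],
    [d = f^2] and [c^2 + d^2 = a = g^2], so [e^4 + f^4 = g^2] with [g < z]. *)
Lemma no_fourth_powers_sum x y z : coprime x y -> 0 < x -> 0 < y ->
  x ^ 4 + y ^ 4 <> z ^ 2.
Proof.
elim/ltn_ind: z x y => z IH.
have step x y : ~~ odd y -> coprime x y -> 0 < x -> 0 < y ->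
    x ^ 4 + y ^ 4 <> z ^ 2.
  move=> ey cxy x0 y0 E.
  have [||||a [b [cab b0 xE yE zE]]] := @primitive_triple (x ^ 2) (y ^ 2) z.
  - by rewrite coprimeXl// coprimeXr.
  - by rewrite oddX.
  - by rewrite expn_gt0 y0.
  - by rewrite -!expnM.
  have cxb : coprime x b by rewrite -coprime_sqr_add xE coprimeXl.
  have ox := odd_of_coprime_even cxy ey.
  have eb : ~~ odd b by have [|//] := even_leg xE; rewrite ox.
  have [c [d [ccd d0 xE' bE aE]]] := primitive_triple cxb eb b0 xE.
  have [h yh] := even_exists_half ey.
  have hE : a * (c * d) = h ^ 2 by move: yE; rewrite bE yh; clear; lia.
  have cacd : coprime a (c * d).
    by move: cab; rewrite bE -mulnA coprimeMr => /andP[].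
  have [[g ag] [k cdk]] := coprime_mul_square cacd hE.
  have [[e cE] [f dE]] := coprime_mul_square ccd cdk.
  have c0 : 0 < c by move: b0; rewrite bE !muln_gt0 => /andP[].
  apply: (IH g _ e f).
  - by rewrite zE ag ltn_quartic_add.
  - by move: ccd; rewrite cE dE coprime_pexpl// coprime_pexpr.
  - by move: c0; rewrite cE expn_gt0 orbF.
  - by move: d0; rewrite dE expn_gt0 orbF.
  - by rewrite -ag aE cE dE -!expnM.
move=> x y cxy x0 y0 E.
have E2 : (x ^ 2) ^ 2 + (y ^ 2) ^ 2 = z ^ 2 by rewrite -!expnM.
have [ex|ey] := even_leg E2.
  apply: (step y x); rewrite // ?(coprime_sym y) ?(addnC (y ^ 4)) //.
  by move: ex; rewrite oddX.
by apply: (step x y) => //; move: ey; rewrite oddX.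
Qed.

(** A primitive Pythagorean triangle whose area is the square [w^2] yields a
    smaller pair [s, t] with [s^2 + t^2] and [s^2 - t^2] both squares: in terms
    of the parameters [w^2 = a b (a - b) (a + b)], and the four factors are
    pairwise coprime, hence all squares. *)
Lemma square_area_descent p q x w : coprime p q -> ~~ odd q -> 0 < q ->
  p ^ 2 + q ^ 2 = x ^ 2 -> p * q = 2 * w ^ 2 ->
  exists s t u v, [/\ s < x, coprime s t, 0 < t, s ^ 2 + t ^ 2 = u ^ 2
    & t ^ 2 + v ^ 2 = s ^ 2].
Proof.
move=> cpq eq q0 E pqE.
have [a [b [cab b0 pE qE xE]]] := primitive_triple cpq eq q0 E.
have op := odd_of_coprime_even cpq eq.
have wE : p * (a * b) = w ^ 2 by move: pqE; rewrite qE; clear; lia.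
have cpab : coprime p (a * b) by move: cpq; rewrite qE -mulnA coprimeMr => /andP[].
have [[k pk] [l abl]] := coprime_mul_square cpab wE.
have [[s aE] [t bE]] := coprime_mul_square cab abl.
have ba : b <= a by rewrite -leq_sqr -pE leq_addl.
pose d := a - b; have ad : a = b + d by rewrite /d; lia.
have pd : d * (2 * b + d) = k ^ 2 by rewrite -pk; move: pE; rewrite ad; clear; lia.
(* [d] and [2 b + d] stand for [a - b] and [a + b]. *)
have cdb : coprime d (2 * b + d).
  have od : odd d by move: op; rewrite pk -pd oddM => /andP[].
  rewrite /coprime gcdnDr -/(coprime _ _) coprimeMr coprimen2 od /=.
  by move: cab; rewrite ad /coprime gcdnC gcdnDl gcdnC.
have [[v dE] [u uE]] := coprime_mul_square cdb pd.
exists s, t, u, v; split.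
- by rewrite xE aE ltn_quartic_add.
- by move: cab; rewrite aE bE coprime_pexpl// coprime_pexpr.
- by move: b0; rewrite bE expn_gt0 orbF.
- by rewrite -aE -bE -uE; lia.
- by rewrite -aE -bE -dE.
Qed.

(** This is Fermat's theorem that the area of a Pythagorean triangle is never a
    square: the half sum and half difference of [u] and [v] are the legs of a
    triangle with hypotenuse [x] and area [(y/2)^2], to which
    [square_area_descent] applies. *)
Lemma no_sum_and_difference_squares x y u v : coprime x y -> 0 < y ->
  x ^ 2 + y ^ 2 = u ^ 2 -> y ^ 2 + v ^ 2 = x ^ 2 -> False.
Proof.
elim/ltn_ind: x y u v => x IH y u v cxy y0 Eu Ev.
have yy : 0 < y ^ 2 by rewrite expn_gt0 y0.
have uv : v < u by rewrite -ltn_sqr -Eu -Ev; clear -yy; lia.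
have [q uE] : exists q, u = v + 2 * q.
  apply: same_parity_sub (ltnW uv) _.
  have := congr1 odd Eu; have := congr1 odd Ev; rewrite !oddD !oddX /= => <-.
  by case: (odd y); case: (odd v); case: (odd u).
pose p := v + q.
have E : p ^ 2 + q ^ 2 = x ^ 2 by move: Eu Ev; rewrite /p uE; clear; lia.
have yE : 2 * (p * q) = y ^ 2 by move: Eu Ev; rewrite /p uE; clear; lia.
have ey : ~~ odd y by have := congr1 odd yE; rewrite oddM oddX /= => <-.
have [w wE] := even_exists_half ey.
have pqE : p * q = 2 * w ^ 2 by move: yE; rewrite wE; clear; lia.
(* Here [x^2 = p^2 + q^2] and [y^2 = 2 p q] are coprime. *)
have cpq : coprime p q.
  have : coprime (x ^ 2) (y ^ 2) by rewrite coprimeXl// coprimeXr.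
  by rewrite -E -yE !coprimeMr => /and3P[_ _]; rewrite coprime_sqr_add.
have [q0 p0] : 0 < q /\ 0 < p.
  by apply/andP; rewrite -muln_gt0; move: yy; rewrite -yE muln_gt0 mulnC.
have [eq|ep] : ~~ odd q \/ ~~ odd p.
  by have := congr1 odd pqE; rewrite !oddM /=; case: (odd p); case: (odd q); auto.
- have [s [t [u' [v' [? ? ? ? ?]]]]] := square_area_descent cpq eq q0 E pqE.
  by apply: (IH s _ t u' v').
- rewrite coprime_sym in cpq; rewrite addnC in E; rewrite mulnC in pqE.
  have [s [t [u' [v' [? ? ? ? ?]]]]] := square_area_descent cpq ep p0 E pqE.
  by apply: (IH s _ t u' v').
Qed.

End Descent.

(** * Secants, tangents and rational squares *)

Lemma posrat_fraction (q : rat) : 0 < q -> exists x y : nat,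
  [/\ (0 < x)%N, (0 < y)%N, coprime x y & q = x%:R / y%:R].
Proof.
move=> q0; exists `|numq q|%N, `|denq q|%N; split.
- by rewrite absz_gt0 numq_eq0 gt_eqF.
- by rewrite absz_gt0 denq_eq0.
- exact: coprime_num_den.
- by rewrite !natr_absz gtr0_norm ?numq_gt0// gtr0_norm ?denq_gt0// divq_num_den.
Qed.

Lemma nat_sqr_of_rat_sqr (N : nat) (r : rat) : N%:R = r ^+ 2 ->
  exists u, N = (u ^ 2)%N.
Proof.
have [-> Nr|r0 Nr] := eqVneq r 0.
  by exists 0%N; apply/eqP; move/eqP: Nr; rewrite expr0n /= pnatr_eq0.
have [|x [y [_ y0 _ rE]]] := @posrat_fraction `|r|; first by rewrite normr_gt0.
have Ny : (N * y ^ 2 = x ^ 2)%N.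
  apply/eqP; rewrite -(eqr_nat rat) natrM !natrX Nr -[r ^+ 2]real_normK ?num_real// rE.
  by rewrite expr_div_n divfK// expf_neq0// pnatr_eq0 -lt0n.
have : (y ^ 2 %| x ^ 2)%N by rewrite -Ny dvdn_mull.
rewrite dvdn_pexp2r// => /dvdnP[u xE]; exists u; apply/eqP.
by rewrite -(@eqn_pmul2r (y ^ 2)) ?expn_gt0 ?y0// Ny xE expnMn.
Qed.

Lemma secant_sub1_sqr q : secant_set q -> exists r, q ^+ 2 - 1 = r ^+ 2.
Proof.
move=> [m [n [m0 n0 ->]]]; exists ((m%:R ^+ 2 - n%:R ^+ 2) / (2 * m%:R * n%:R)).
by field; rewrite !pnatr_eq0 -!lt0n m0 n0.
Qed.

Lemma tangent_add1_sqr q : tangent_set q -> exists r, q ^+ 2 + 1 = r ^+ 2.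
Proof.
move=> [m [n [m0 n0 nm ->]]].
exists ((m%:R ^+ 2 + n%:R ^+ 2) / (m%:R ^+ 2 - n%:R ^+ 2)).
by field; rewrite subr_eq0 -!natrX eqr_nat eqn_exp2r// gtn_eqF.
Qed.

(** For [q <> 1] the quotient [(q^4 - 1) / (q^2 - 1) = q^2 + 1] is a square as
    well, so [q^2 + 1] and [q^2 - 1] are both squares; clearing the denominator
    of [q] brings this to [no_sum_and_difference_squares]. *)
Lemma secant_sqr_eq1 q : 0 < q -> secant_set q -> secant_set (q * q) -> q = 1.
Proof.
move=> q0 /secant_sub1_sqr[r rE] /secant_sub1_sqr[s sE].
apply/eqP; apply: contraT => q1.
have q21 : q ^+ 2 - 1 != 0 by rewrite subr_eq0 sqrp_eq1// ltW.
have r0 : r != 0 by move: q21; rewrite rE sqrf_eq0.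
have tE : q ^+ 2 + 1 = (s / r) ^+ 2.
  by rewrite expr_div_n -sE -rE; field.
have [x [y [x0 y0 cxy qE]]] := posrat_fraction q0.
have yn : y%:R != 0 :> rat by rewrite pnatr_eq0 -lt0n.
have [|u uE] := @nat_sqr_of_rat_sqr (x ^ 2 + y ^ 2) (s / r * y%:R).
  by rewrite exprMn -tE qE natrD !natrX; field.
have yx : (y ^ 2 <= x ^ 2)%N.
  rewrite -(ler_nat rat) !natrX.
  have : 0 <= q ^+ 2 - 1 by rewrite rE sqr_ge0.
  by rewrite qE subr_ge0 expr_div_n ler_pdivlMr ?mul1r// exprn_gt0// ltr0n.
have [|v vE] := @nat_sqr_of_rat_sqr (x ^ 2 - y ^ 2) (r * y%:R).
  by rewrite exprMn -rE qE natrB// !natrX; field.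
by case: (@no_sum_and_difference_squares x y u v); rewrite // -vE subnKC.
Qed.

Lemma not_tangent_sqr q : 0 < q -> ~ tangent_set (q * q).
Proof.
move=> q0 /tangent_add1_sqr[r rE].
have [x [y [x0 y0 cxy qE]]] := posrat_fraction q0.
have yn : y%:R != 0 :> rat by rewrite pnatr_eq0 -lt0n.
have [|z zE] := @nat_sqr_of_rat_sqr (x ^ 4 + y ^ 4) (r * y%:R ^+ 2).
  by rewrite exprMn -rE qE natrD !natrX; field.
exact: no_fourth_powers_sum zE.
Qed.

Theorem proposition1p11 :
  (~ exists S : set rat,
       [/\ subsemigroup_posrat S, infinite_set S & S `<=` secant_set]) /\
  (~ exists S : set rat,
       [/\ subsemigroup_posrat S, infinite_set S & S `<=` tangent_set]).
Proof.
split=> -[S [[Spos Smul] Sinf Ssub]].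
- apply: Sinf; apply: sub_finite_set (finite_set1 (1 : rat)) => q Sq.
  by apply: secant_sqr_eq1; [exact: Spos | exact: Ssub | exact/Ssub/Smul].
- have [q Sq] := infinite_setN0 Sinf.
  exact: not_tangent_sqr (Spos _ Sq) (Ssub _ (Smul _ _ Sq Sq)).
Qed.
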